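(* For every integer $n\ge0$, $\overline{S_3^2}(2n+1)=2\,\overline{S_3}(4n+2)$.
   Context: For $|q|<1$ and a positive integer $k$, write $f_k=\prod_{j\ge1}(1-q^{kj})$. For a positive integer $r$, $\overline{S_3^r}(n)$ (number of $3$-Schur overpartitions of $n$ with $r$-tuples) is defined by $\sum_{n\ge0}\overline{S_3^r}(n)q^n=\prod_{n\ge1}\frac{(1+q^{2n-1})^r(1-q^{3(2n-1)})^r}{(1+q^{3(2n-1)})^r(1-q^{2n-1})^r}=\frac{f_2^{3r}f_3^{2r}f_{12}^r}{f_1^{2r}f_4^rf_6^{3r}}$, and $\overline{S_3}(n)=\overline{S_3^1}(n)$. *)

(* Defs.v *)
From HB Require Import structures.
From mathcomp Require Import all_boot all_order all_algebra.
From mathcomp Require Import boolp.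

Set Implicit Arguments.
Unset Strict Implicit.
Unset Printing Implicit Defensive.

Import GRing.Theory.
Local Open Scope ring_scope.

(* Formal power series.  The record keeps [{fps R}] apart from the function   *)
(* type [nat -> R], on which multiplication is pointwise.                     *)

Record fps (R : Type) := Fps { coefs : nat -> R }.
Notation "{ 'fps' R }" := (fps R) (at level 0, format "{ 'fps'  R }").

HB.instance Definition _ (R : Type) := gen_eqMixin {fps R}.
HB.instance Definition _ (R : Type) := gen_choiceMixin {fps R}.

Lemma fpsP (R : Type) (a b : {fps R}) : coefs a =1 coefs b -> a = b.
Proof. by case: a b => [a] [b] /= /funext ->. Qed.

Section FpsZmod.
Variable R : zmodType.
Implicit Types a b c : {fps R}.

Definition fps_zero : {fps R} := Fps (fun=> 0).
Definition fps_opp a : {fps R} := Fps (fun n => - coefs a n).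
Definition fps_add a b : {fps R} := Fps (fun n => coefs a n + coefs b n).

Fact fps_addA : associative fps_add.
Proof. by move=> a b c; apply: fpsP => n /=; rewrite addrA. Qed.
Fact fps_addC : commutative fps_add.
Proof. by move=> a b; apply: fpsP => n /=; rewrite addrC. Qed.
Fact fps_add0 : left_id fps_zero fps_add.
Proof. by move=> a; apply: fpsP => n /=; rewrite add0r. Qed.
Fact fps_addN : left_inverse fps_zero fps_opp fps_add.
Proof. by move=> a; apply: fpsP => n /=; rewrite addNr. Qed.

HB.instance Definition _ :=
  GRing.isZmodule.Build {fps R} fps_addA fps_addC fps_add0 fps_addN.

End FpsZmod.

Section FpsRing.
Variable R : comNzRingType.
Implicit Types a b c : {fps R}.

Definition fps_one : {fps R} := Fps (fun n => (n == 0)%:R).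
Definition fps_mul a b : {fps R} :=
  Fps (fun n => \sum_(i < n.+1) coefs a i * coefs b (n - i)%N).

Definition fps_trunc m a : {poly R} := \poly_(i < m) coefs a i.

Fact coefs_mul_trunc m n a b : (n < m)%N ->
  coefs (fps_mul a b) n = (fps_trunc m a * fps_trunc m b)`_n.
Proof.
move=> nm; rewrite coefM /=; apply: eq_bigr => i _.
have ltim : (i < m)%N := leq_trans (ltn_ord i) nm.
by rewrite !coef_poly ltim (leq_ltn_trans (leq_subr i n) nm).
Qed.

Fact fps_mulC : commutative fps_mul.
Proof.
by move=> a b; apply: fpsP => n; rewrite !(coefs_mul_trunc _ _ (ltnSn n)) mulrC.
Qed.

Fact fps_mulA : associative fps_mul.
Proof.
move=> a b c; apply: fpsP => n.
transitivity ((fps_trunc n.+1 a * (fps_trunc n.+1 b * fps_trunc n.+1 c))`_n).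
  rewrite coefM /=; apply: eq_bigr => i _.
  have lenin : (n - i < n.+1)%N by rewrite ltnS leq_subr.
  by rewrite -(coefs_mul_trunc _ _ lenin) coef_poly ltn_ord.
rewrite mulrA coefM /=; apply: eq_bigr => i _.
have lenin : (n - i < n.+1)%N by rewrite ltnS leq_subr.
by rewrite -(coefs_mul_trunc _ _ (ltn_ord i)) coef_poly lenin.
Qed.

Fact fps_mul1 : left_id fps_one fps_mul.
Proof.
move=> a; apply: fpsP => n /=; rewrite big_ord_recl subn0 mul1r.
by rewrite big1 ?addr0 // => i _; rewrite mul0r.
Qed.

Fact fps_mulDl : left_distributive fps_mul (@fps_add R).
Proof.
move=> a b c; apply: fpsP => n /=.
by rewrite -big_split /=; apply: eq_bigr => i _; rewrite mulrDl.
Qed.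

Fact fps_one_neq0 : fps_one != fps_zero R.
Proof.
apply/eqP => /(congr1 (fun a => coefs a 0)) /= /eqP.
by rewrite oner_eq0.
Qed.

HB.instance Definition _ := GRing.Zmodule_isComNzRing.Build {fps R}
  fps_mulA fps_mulC fps_mul1 fps_mulDl fps_one_neq0.

Lemma coefs0 n : coefs (0 : {fps R}) n = 0. Proof. by []. Qed.
Lemma coefs1 n : coefs (1 : {fps R}) n = (n == 0)%:R. Proof. by []. Qed.
Lemma coefsN a n : coefs (- a) n = - coefs a n. Proof. by []. Qed.
Lemma coefsD a b n : coefs (a + b) n = coefs a n + coefs b n.
Proof. by []. Qed.
Lemma coefsB a b n : coefs (a - b) n = coefs a n - coefs b n.
Proof. by []. Qed.
Lemma coefsM a b n :
  coefs (a * b) n = \sum_(i < n.+1) coefs a i * coefs b (n - i)%N.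
Proof. by []. Qed.
Lemma coefsM0 a b : coefs (a * b) 0 = coefs a 0 * coefs b 0.
Proof. by rewrite coefsM big_ord1. Qed.

Definition fpsX : {fps R} := Fps (fun n => (n == 1)%:R).

Lemma coefsXM a n : coefs (fpsX * a) n = if n is m.+1 then coefs a m else 0.
Proof.
rewrite coefsM; case: n => [|n]; first by rewrite big_ord1 mul0r.
rewrite big_ord_recl mul0r add0r big_ord_recl mul1r /= subSS subn0.
by rewrite big1 ?addr0 // => i _; rewrite mul0r.
Qed.

Lemma coefsXn m n : coefs (fpsX ^+ m) n = (n == m)%:R.
Proof.
elim: m n => [|m IHm] n; first by rewrite expr0.
by rewrite exprS coefsXM; case: n => [|n] //; rewrite IHm.
Qed.

End FpsRing.

Arguments fpsX {R}.

Section FpsUnit.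
Variable R : comUnitRingType.
Implicit Types a b : {fps R}.

(* The list of the first n coefficients of 1 / a, from the recursion          *)
(* b_0 = 1 / a_0,  b_n = - (a_n b_0 + ... + a_1 b_(n-1)) / a_0.               *)
Fixpoint fps_inv_seq a n : seq R :=
  if n is m.+1 then
    let s := fps_inv_seq a m in
    rcons s ((coefs a 0)^-1 *
      ((m == 0)%:R - \sum_(i < m) coefs a (m - i)%N * s`_i))
  else [::].

Definition fps_unit : {pred {fps R}} := [pred a | coefs a 0 \is a GRing.unit].
Definition fps_inv a : {fps R} :=
  if a \in fps_unit then Fps (fun n => (fps_inv_seq a n.+1)`_n) else a.

Fact size_fps_inv_seq a n : size (fps_inv_seq a n) = n.
Proof. by elim: n => //= n IHn; rewrite size_rcons IHn. Qed.

Fact nth_fps_inv_seq a n i : (i < n)%N ->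
  (fps_inv_seq a n)`_i = (fps_inv_seq a i.+1)`_i.
Proof.
elim: n => // n IHn; rewrite ltnS leq_eqVlt => /predU1P[-> // | ltin].
by rewrite [fps_inv_seq a n.+1]/= nth_rcons size_fps_inv_seq ltin IHn.
Qed.

Fact fps_mulVx : {in fps_unit, left_inverse 1 fps_inv *%R}.
Proof.
move=> a Ua; rewrite /fps_inv Ua; apply: fpsP => n.
rewrite mulrC coefsM big_ord_recl subn0.
have -> : \sum_(i < n) coefs a (lift ord0 i) *
    coefs (Fps (fun n => (fps_inv_seq a n.+1)`_n)) (n - lift ord0 i) =
    \sum_(i < n) coefs a (n - i)%N * (fps_inv_seq a n)`_i.
  rewrite (reindex_inj rev_ord_inj) /=; apply: eq_bigr => i _.
  rewrite /bump /= add1n -subSn ?ltn_ord // subSS subKn 1?ltnW //.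
  by rewrite [in RHS]nth_fps_inv_seq.
rewrite [coefs (Fps _) n]/= nth_rcons size_fps_inv_seq ltnn eqxx /=.
by rewrite mulrA mulrV // mul1r subrK.
Qed.

Fact fps_unitPl a b : b * a = 1 -> fps_unit a.
Proof.
move=> /(congr1 (fun c => coefs c 0)); rewrite coefsM0 => ba1.
by apply/unitrPr; exists (coefs b 0); rewrite mulrC.
Qed.

Fact fps_inv_out : {in [predC fps_unit], fps_inv =1 id}.
Proof. by move=> a; rewrite inE /fps_inv => /negPf ->. Qed.

HB.instance Definition _ := GRing.ComNzRing_hasMulInverse.Build {fps R}
  fps_mulVx fps_unitPl fps_inv_out.

Lemma fps_unitE a : (a \is a GRing.unit) = (coefs a 0 \is a GRing.unit).
Proof. by []. Qed.

End FpsUnit.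

(* The infinite product F 1 * F 2 * ...; the coefficient of q^n is read off   *)
(* the n-th partial product.  This is the formal limit of the partial         *)
(* products as soon as F k = 1 + O(q^k); see [fps_infprodP].                  *)
Definition fps_infprod (R : comNzRingType) (F : nat -> {fps R}) : {fps R} :=
  Fps (fun n => coefs (\prod_(1 <= k < n.+1) F k) n).

Definition fps_eqmod (R : Type) k (a b : {fps R}) :=
  forall n, (n < k)%N -> coefs a n = coefs b n.

Lemma fps_eqmodM (R : comNzRingType) k (a b c d : {fps R}) :
  fps_eqmod k a b -> fps_eqmod k c d -> fps_eqmod k (a * c) (b * d).
Proof.
move=> ab cd n ltnk; rewrite !coefsM; apply: eq_bigr => i _.
by rewrite ab ?cd // (leq_ltn_trans _ ltnk) ?leq_subr // -ltnS.
Qed.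

Lemma fps_eqmodX (R : comNzRingType) k (a : {fps R}) r :
  fps_eqmod k a 1 -> fps_eqmod k (a ^+ r) 1.
Proof.
move=> a1; elim: r => [|r IHr]; first by rewrite expr0.
by rewrite exprS -[1]mulr1; apply: fps_eqmodM.
Qed.

Lemma fps_eqmodV (R : comUnitRingType) k (a : {fps R}) :
  fps_eqmod k a 1 -> fps_eqmod k a^-1 1.
Proof.
case: (boolP (a \is a GRing.unit)) => [Ua a1 | /invr_out-> //].
rewrite -(mulVr Ua) -{1}[a^-1]mulr1.
by apply: fps_eqmodM => // n /a1 ->.
Qed.

Lemma fps_infprodP (R : comNzRingType) (F : nat -> {fps R}) :
    (forall k, fps_eqmod k (F k) 1) ->
  forall n N, (n <= N)%N ->
  coefs (\prod_(1 <= k < N.+1) F k) n = coefs (fps_infprod F) n.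
Proof.
move=> F1 n N; elim: N => [|N IHN]; first by rewrite leqn0 => /eqP->.
rewrite leq_eqVlt => /predU1P[-> // | ltnN]; rewrite -IHN // big_nat_recr //=.
rewrite -[X in _ = coefs X n]mulr1.
by apply: (fps_eqmodM (k := N.+1)).
Qed.

Local Notation q := (@fpsX int).

(* The n-th factor (n >= 1) of the product defining the generating function   *)
(* of the 3-Schur overpartitions with r-tuples.                               *)
Definition schur3_factor (r n : nat) : {fps int} :=
  ((1 + q ^+ (2 * n - 1)) ^+ r * (1 - q ^+ (3 * (2 * n - 1))) ^+ r) /
  ((1 + q ^+ (3 * (2 * n - 1))) ^+ r * (1 - q ^+ (2 * n - 1)) ^+ r).

Definition schur3_gf (r : nat) : {fps int} := fps_infprod (schur3_factor r).

Definition schur3 (r n : nat) : int := coefs (schur3_gf r) n.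

Lemma schur3_factor_unit r n : (0 < n)%N ->
  ((1 + q ^+ (3 * (2 * n - 1))) ^+ r * (1 - q ^+ (2 * n - 1)) ^+ r)
    \is a GRing.unit.
Proof.
case: n => // n _; have -> : (2 * n.+1 - 1)%N = (2 * n).+1 by rewrite mulnS.
by rewrite unitrM !unitrX // fps_unitE ?coefsB ?coefsD coefs1 coefsXn.
Qed.

Lemma schur3_factor_eqmod r n : fps_eqmod n (schur3_factor r n) 1.
Proof.
case: n => // n; rewrite /schur3_factor -[1 in X in fps_eqmod _ _ X]mulr1.
set m := (2 * n.+1 - 1)%N.
have lenm : (n < m)%N by rewrite /m mulnS ltnS leq_pmull.
have le3 : (n < 3 * m)%N by rewrite (leq_trans lenm) ?leq_pmull.
have eqD k : (n < k)%N -> fps_eqmod n.+1 (1 + q ^+ k) 1.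
  by move=> ltnk i lein; rewrite coefsD coefsXn ltn_eqF ?addr0 // (leq_trans lein).
have eqB k : (n < k)%N -> fps_eqmod n.+1 (1 - q ^+ k) 1.
  by move=> ltnk i lein; rewrite coefsB coefsXn ltn_eqF ?subr0 // (leq_trans lein).
apply: fps_eqmodM; last apply: fps_eqmodV; rewrite -[1 in X in fps_eqmod _ _ X]mulr1;
  by apply: fps_eqmodM; apply: fps_eqmodX; auto.
Qed.

Lemma schur3E r n N : (n <= N)%N ->
  schur3 r n = coefs (\prod_(1 <= k < N.+1) schur3_factor r k) n.
Proof. by move=> leN; rewrite (fps_infprodP (@schur3_factor_eqmod r) leN). Qed.

(* Main.v *)
Require Import Defs.
From mathcomp Require Import all_boot all_order all_algebra.
From mathcomp Require Import zify ring.

(* Write p_a = phi(q^a) and m_a = phi(-q^a) for phi(q) = sum_(i in Z) q^(i^2).    *)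
(* Gauss's product for m_a, obtained from Shanks' finite identity, turns the      *)
(* generating function into A = m_2 m_3 / (m_1 m_6).  Changes of variables in     *)
(* Z^2 give p_a m_a = m_(2a)^2, p_a^2 + m_a^2 = 2 p_(2a)^2 and                    *)
(* p_1 m_3 + m_1 p_3 = 2 m_4 m_12.  With E = m_2 m_6 / (m_1 m_3), the last one    *)
(* is the dissection A(q) + A(-q) = 2 E(q^2).  Eliminating p_2, p_6, m_4, m_12    *)
(* yields the degree 3 modular equation, which reads                              *)
(* A(q)^2 - A(-q)^2 = 2 (E(q) - E(-q)).  So the coefficient of q^(2n+1) in A^2    *)
(* is twice that in E, which is the coefficient of q^(4n+2) in A.                 *)

Set Implicit Arguments.
Unset Strict Implicit.
Unset Printing Implicit Defensive.

Import Order.TTheory GRing.Theory Num.Theory.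
Local Open Scope ring_scope.

(** By [schur3_gf2] the series of [schur3 2] is A^2, so the claim compares the odd part of A^2 with
    the even part of A. The single quotient E carries both: [dissection_sum] says that the even part
    of A is E(q^2), and [dissection_diff] that the odd part of A^2 is twice the odd part of E. These
    rest on [schur3_gf_theta], which writes A through [phin], and on [phi_mul_phin],
    [phi_sqr_add_phin_sqr], [phi_phin_cubic], proved by matching lattice points on ellipses;
    [phi_modular3] follows from these three. The map q -> -q exchanges [phin a] and [phi a] for odd
    a and fixes [phin a] for even a. *)

Local Notation q := (@fpsX int).

(** * Shanks' finite form of Gauss's identity *)

Section Shanks.
Variables (R : comUnitRingType) (t : R).
Hypothesis unit1D : forall k, (0 < k)%N -> 1 + t ^+ k \is a GRing.unit.

Definition shanks_prod m n : R :=
  \prod_(m <= k < n) ((1 - t ^+ k.+1) / (1 + t ^+ k.+1)).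

(* [2 / (1 + t ^+ s)], read as [1] at [s = 0], where [2] need not be a unit. *)
Definition shanks_weight s : R := if s == 0%N then 1 else 2 / (1 + t ^+ s).

(** The term s = 0 is the finite Gauss product; every other one is a multiple of t^(n+1). *)
Definition shanks_term n s : R :=
  (-1) ^+ s * shanks_weight s * t ^+ (s * n.+1) * shanks_prod s n.

Lemma shanks_weightM s : shanks_weight s * (1 + t ^+ s) = 2.
Proof.
rewrite /shanks_weight; case: eqP => [->|/eqP]; first by rewrite expr0 mul1r.
by rewrite -lt0n => /unit1D ?; rewrite divrK.
Qed.

(** Passing from n to n+1 changes each term by a difference in s, so the partial sums have a closed
    form, found by induction on m. *)
Lemma shanks_telescope n m : (m < n.+2)%N ->
  (1 + t ^+ n.+1) * \sum_(s < m) (shanks_term n.+1 s - shanks_term n s) =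
  if m is m'.+1 then 2 * (-1) ^+ m * t ^+ (m * n.+1) * shanks_prod m' n else 0.
Proof.
have Un := unit1D (ltn0Sn n).
elim: m => [|m IHm] ltmn; first by rewrite big_ord0 mulr0.
rewrite big_ord_recr mulrDr IHm 1?ltnW //=.
have -> : (1 + t ^+ n.+1) * (shanks_term n.+1 m - shanks_term n m) =
    (-1) ^+ m * shanks_weight m * t ^+ (m * n.+1) * shanks_prod m n *
    (t ^+ m * (1 - t ^+ n.+1) - (1 + t ^+ n.+1)).
  have tm : t ^+ (m * n.+2) = t ^+ (m * n.+1) * t ^+ m by rewrite mulnS addnC exprD.
  have Pm : (1 + t ^+ n.+1) * shanks_prod m n.+1 = shanks_prod m n * (1 - t ^+ n.+1).
    by rewrite /shanks_prod big_nat_recr //= mulrCA [_ / _]mulrC mulVKr.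
  rewrite /shanks_term tm mulrBr [in LHS]mulrCA Pm; ring.
have wm := shanks_weightM m.
have tn : t ^+ (m.+1 * n.+1) = t ^+ (m * n.+1) * t ^+ n.+1.
  by rewrite mulSn addnC exprD.
rewrite tn (exprS (-1) m).
case: m => [|m] in ltmn wm {IHm tn} *.
  by rewrite add0r mul0n /shanks_weight eqxx !expr0; ring.
have -> : shanks_prod m n = (1 - t ^+ m.+1) / (1 + t ^+ m.+1) * shanks_prod m.+1 n.
  by rewrite /shanks_prod big_ltn.
have -> : shanks_weight m.+1 = 2 / (1 + t ^+ m.+1) by [].
have := mulrV (unit1D (ltn0Sn m)).
(* The inverse v of 1 + t^(m+1) enters [ring] only through the rule t^(m+1) v = 1 - v. *)
set v := _^-1; rewrite mulrDl mul1r => /(canRL (addKr _)) Vm.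
ring: Vm.
Qed.

Lemma shanks n :
  \sum_(s < n.+1) shanks_term n s =
  1 + 2 * \sum_(j < n) (-1) ^+ j.+1 * t ^+ (j.+1 ^ 2).
Proof.
elim: n => [|n IHn].
  by rewrite big_ord1 big_ord0 mulr0 addr0 /shanks_term /shanks_prod big_geq ?mulr1.
rewrite big_ord_recr [in RHS]big_ord_recr /= mulrDr addrA -IHn.
have := shanks_telescope (ltnSn n.+1).
rewrite sumrB /= [shanks_prod n n]big_geq // mulr1 => tele.
have Un := unit1D (ltn0Sn n).
rewrite [shanks_term n.+1 n.+1]/shanks_term [shanks_prod n.+1 n.+1]big_geq // mulr1.
have -> : shanks_weight n.+1 = 2 / (1 + t ^+ n.+1) by [].
apply: (mulrI Un); rewrite !mulrDr.
rewrite mulrBr in tele; rewrite (canRL (subrK _) tele).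
have := mulrV Un; set v := _^-1; rewrite mulrDl mul1r => /(canRL (addKr _)) Vn.
have -> : t ^+ (n.+1 * n.+2) = t ^+ (n.+1 ^ 2) * t ^+ n.+1 by rewrite -exprD mulnS addnC mulnn.
rewrite mulnn; ring: Vn.
Qed.
End Shanks.

(** * Theta series as sums over lattice points *)

Lemma reindex_uniq (V : nmodType) (T1 T2 : eqType) (s1 : seq T1) (s2 : seq T2)
    (P1 : pred T1) (P2 : pred T2) (f : T1 -> T2) (g : T2 -> T1) (F : T2 -> V) :
    uniq s1 -> uniq s2 ->
    (forall x, x \in s1 -> P1 x -> [/\ f x \in s2, P2 (f x) & g (f x) = x]) ->
    (forall y, y \in s2 -> P2 y -> [/\ g y \in s1, P1 (g y) & f (g y) = y]) ->
  \sum_(y <- s2 | P2 y) F y = \sum_(x <- s1 | P1 x) F (f x).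
Proof.
move=> U1 U2 fP gP; rewrite -[RHS]big_filter -[LHS]big_filter -(big_map f xpredT).
apply: perm_big; apply: uniq_perm; first exact: filter_uniq.
  rewrite map_inj_in_uniq ?filter_uniq // => x y.
  rewrite !mem_filter => /andP[Px sx] /andP[Py sy] fxy.
  by have [_ _ <-] := fP x sx Px; have [_ _ <-] := fP y sy Py; rewrite fxy.
move=> y; rewrite mem_filter; apply/andP/mapP => [[Py sy]|[x]].
  by have [sx Px <-] := gP y sy Py; exists (g y) => //; rewrite mem_filter Px.
by rewrite mem_filter => /andP[Px sx] ->; have [] := fP x sx Px.
Qed.

Definition zrange n : seq int := [seq i%:Z - n%:Z | i <- iota 0 (2 * n + 1)].

Lemma mem_zrange n (i : int) : (i \in zrange n) = (`|i| <= n)%N.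
Proof.
apply/mapP/idP => [[k]|lein]; first by rewrite mem_iota; lia.
by exists (absz (i + n%:Z)); rewrite ?mem_iota; lia.
Qed.

Lemma zrange_uniq n : uniq (zrange n).
Proof. by rewrite map_inj_uniq ?iota_uniq // => i j; lia. Qed.

Definition zpairs n : seq (int * int) := [seq (i, j) | i <- zrange n, j <- zrange n].

Lemma mem_zpairs n x : (x \in zpairs n) = (`|x.1| <= n)%N && (`|x.2| <= n)%N.
Proof.
rewrite -!mem_zrange; apply/allpairsP/andP => [[y [? ? ->]] //|[? ?]].
by exists x; rewrite -?surjective_pairing.
Qed.

Lemma zpairs_uniq n : uniq (zpairs n).
Proof. by apply: allpairs_uniq; rewrite ?zrange_uniq // => [[? ?] [? ?]]. Qed.

(* For [0 < a] this is the sum of [w i * q ^ (a i^2)] over all integers [i]: then  *)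
(* [a i^2 = n] forces [`|i| <= n].                                                *)
Definition theta (w : int -> int) (a : nat) : {fps int} :=
  Fps (fun n => \sum_(i <- zrange n | a%:Z * i ^+ 2 == n%:Z) w i).

Lemma coefs_theta w a n N : (0 < a)%N -> (n <= N)%N ->
  coefs (theta w a) n = \sum_(i <- zrange N | a%:Z * i ^+ 2 == n%:Z) w i.
Proof.
move=> a0 leN; apply: (@reindex_uniq _ _ _ _ _ _ _ id id);
  rewrite ?zrange_uniq // => i; rewrite !mem_zrange => lei Hi; split=> //.
  by move/eqP: Hi => /=; nia.
exact: leq_trans lei leN.
Qed.

Definition on_level (a b n : nat) (x : int * int) :=
  a%:Z * x.1 ^+ 2 + b%:Z * x.2 ^+ 2 == n%:Z.

Lemma on_level_zpairs a b n x : (0 < a)%N -> (0 < b)%N ->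
  on_level a b n x -> x \in zpairs n.
Proof.
case: x => i j a0 b0; rewrite /on_level mem_zpairs => /= /eqP H.
apply/andP; split; nia.
Qed.

Lemma coefs_thetaM w w' a b n : (0 < a)%N -> (0 < b)%N ->
  coefs (theta w a * theta w' b) n =
  \sum_(x <- zpairs n | on_level a b n x) w x.1 * w' x.2.
Proof.
move=> a0 b0; rewrite coefsM.
(* The ellipse is sliced by the value of a i^2, which is at most n there, so [inord] never takes its
   default value. *)
rewrite [RHS](partition_big (fun x => inord `|a%:Z * x.1 ^+ 2| : 'I_n.+1) xpredT) //.
apply: eq_bigr => k _; have lekn : (k <= n)%N := ltn_ord k.
rewrite (coefs_theta _ a0 lekn) (coefs_theta _ b0 (leq_subr k n)).
rewrite big_distrlr /= [RHS]big_mkcond big_allpairs /= [LHS]big_mkcond.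
apply: eq_big_seq => i; rewrite mem_zrange => lein.
have -> : (if a%:Z * i ^+ 2 == k then
    \sum_(j <- zrange n | b%:Z * j ^+ 2 == (n - k)%N) w i * w' j else 0) =
  \sum_(j <- zrange n) if (a%:Z * i ^+ 2 == k) && (b%:Z * j ^+ 2 == (n - k)%N)
    then w i * w' j else 0.
  by case: eqP => _; [rewrite big_mkcond | rewrite big1].
apply: eq_bigr => j _; congr (if _ then _ else _).
rewrite /on_level /= -subzn //.
have a2 : 0 <= a%:Z * i ^+ 2 by nia.
have b2 : 0 <= b%:Z * j ^+ 2 by nia.
move: (a%:Z * _) (b%:Z * _) a2 b2 => u v u0 v0.
apply/andP/andP => -[/eqP H1 /eqP H2].
  by split; apply/eqP; [lia | apply: val_inj; rewrite /= inordK; lia].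
move: H2 => /(congr1 val) /=; rewrite inordK; last by lia.
by split; apply/eqP; lia.
Qed.

Lemma reindex_level (a b a' b' n : nat) (P P' : pred (int * int))
    (f g : int * int -> int * int) (F : int * int -> int) :
    (0 < a)%N -> (0 < b)%N -> (0 < a')%N -> (0 < b')%N ->
    (forall x, on_level a b n x -> P x ->
       [/\ on_level a' b' n (f x), P' (f x) & g (f x) = x]) ->
    (forall y, on_level a' b' n y -> P' y ->
       [/\ on_level a b n (g y), P (g y) & f (g y) = y]) ->
  \sum_(y <- zpairs n | on_level a' b' n y && P' y) F y =
  \sum_(x <- zpairs n | on_level a b n x && P x) F (f x).
Proof.
move=> a0 b0 a'0 b'0 fP gP; apply: (@reindex_uniq _ _ _ _ _ _ _ f g);
  rewrite ?zpairs_uniq // => x _ /andP[].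
- move=> Lx Px; have [Lf Pf gf] := fP x Lx Px.
  by rewrite (on_level_zpairs _ _ Lf) ?Lf.
- move=> Lx Px; have [Lf Pf gf] := gP x Lx Px.
  by rewrite (on_level_zpairs _ _ Lf) ?Lf.
Qed.

(** * Quadratic identities between theta series *)

Definition zsign (i : int) : int := (-1) ^+ odd `|i|.

Lemma zsignM i j : zsign i * zsign j = (-1) ^+ (odd `|i| != odd `|j|).
Proof. by rewrite /zsign; do 2 case: odd. Qed.

Definition phi (a : nat) : {fps int} := theta (fun=> 1) a.
Definition phin (a : nat) : {fps int} := theta zsign a.

Definition same_parity (x : int * int) := odd `|x.1| == odd `|x.2|.

(** The map (u, v) -> (u + v, u - v) doubles the form u^2 + v^2, and its image is the set of pairs
    of equal parity. *)
Lemma even_level_sum a n F : (0 < a)%N ->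
  \sum_(x <- zpairs n | on_level a a n x && same_parity x) F x =
  \sum_(x <- zpairs n | on_level (2 * a) (2 * a) n x) F (x.1 + x.2, x.1 - x.2) :> int.
Proof.
move=> a0; rewrite -[in RHS](eq_bigl _ _ (fun x => andbT (on_level _ _ n x))).
have a20 : (0 < 2 * a)%N by rewrite muln_gt0.
apply: (@reindex_level (2 * a) (2 * a) a a n xpredT same_parity
  (fun x => (x.1 + x.2, x.1 - x.2))
  (fun y => ((y.1 + y.2) %/ 2, (y.1 - y.2) %/ 2)%Z)) => // -[i j];
  rewrite /on_level /same_parity /= => /eqP Hn Hp.
  by split; [apply/eqP; rewrite -Hn PoszM; ring | lia | congr pair; lia].
set u := ((i + j) %/ 2)%Z; set v := ((i - j) %/ 2)%Z.
have Ei : i = u + v by rewrite /u /v; lia.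
have Ej : j = u - v by rewrite /u /v; lia.
by split => //; [apply/eqP; rewrite -Hn Ei Ej PoszM; ring | rewrite -Ei -Ej].
Qed.

(** Pairs of unequal parity cancel, since swapping the coordinates flips the sign; on the others the
    sign of u - v is the product of the signs of u and v. *)
Lemma phi_mul_phin a : (0 < a)%N -> phi a * phin a = phin (2 * a) ^+ 2.
Proof.
move=> a0; have a20 : (0 < 2 * a)%N by rewrite muln_gt0.
apply: fpsP => n; rewrite expr2 !coefs_thetaM //.
rewrite (bigID same_parity) /= even_level_sum //=.
rewrite [X in _ + X](_ : _ = 0) ?addr0.
  apply: eq_bigr => x _; rewrite mul1r zsignM /zsign; congr (_ ^+ _); lia.
have swap : \sum_(x <- zpairs n | on_level a a n x && ~~ same_parity x) 1 * zsign x.2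
   = \sum_(x <- zpairs n | on_level a a n x && ~~ same_parity x) 1 * zsign x.1.
  apply: (@reindex_level a a a a n (predC same_parity) (predC same_parity)
    (fun x => (x.2, x.1)) (fun x => (x.2, x.1))) => // -[i j];
  by rewrite /on_level /same_parity /= => Hn Hp; split=> //; [rewrite addrC | rewrite eq_sym].
suff : \sum_(x <- zpairs n | on_level a a n x && ~~ same_parity x) 1 * zsign x.2 *+ 2 = 0.
  by rewrite sumrMnl => /eqP; rewrite mulrn_eq0 /= => /eqP.
rewrite sumrMnl mulr2n {1}swap -big_split big1 // => x /andP[_].
by rewrite /same_parity /zsign; do 2 case: odd.
Qed.

(** The combined weight is 2 on pairs of equal parity and 0 on the rest. *)
Lemma phi_sqr_add_phin_sqr a : (0 < a)%N ->
  phi a ^+ 2 + phin a ^+ 2 = 2 * phi (2 * a) ^+ 2.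
Proof.
move=> a0; have a20 : (0 < 2 * a)%N by rewrite muln_gt0.
apply: fpsP => n; rewrite mulr_natl mulr2n !expr2 !coefsD !coefs_thetaM //.
rewrite -!big_split /= [LHS](bigID same_parity) /= even_level_sum //=.
rewrite [X in _ + X]big1 ?addr0.
  apply: eq_bigr => x _; rewrite zsignM.
  by have -> : (odd `|x.1 + x.2| != odd `|x.1 - x.2|) = false by lia.
by move=> x /andP[_]; rewrite zsignM /same_parity => ->.
Qed.

(* The pairs of equal parity on [i^2 + 3 j^2 = n] are [(2a, 2b)] and, when odd,   *)
(* [(a + 3b, a - b)] or [(a + 3b, b - a)] with [a + b] odd, where in all cases    *)
(* [4 a^2 + 12 b^2 = n].                                                          *)
Lemma phi_phin_cubic :
  phi 1 * phin 3 + phin 1 * phi 3 = 2 * (phin 4 * phin 12).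
Proof.
apply: fpsP => n; rewrite mulr_natl mulr2n !coefsD !coefs_thetaM //.
set E := \sum_(x <- zpairs n | on_level 4 12 n x) 1 : int.
set O := \sum_(x <- zpairs n | on_level 4 12 n x && ~~ same_parity x) 1 : int.
have -> : \sum_(x <- zpairs n | on_level 4 12 n x) zsign x.1 * zsign x.2 = E - O *+ 2.
  rewrite /E /O [in RHS]big_mkcondr -sumrMnl -sumrB; apply: eq_bigr => x _.
  by rewrite zsignM /same_parity; do 2 case: odd.
have even_even : \sum_(x <- zpairs n | on_level 1 3 n x &&
    (~~ odd `|x.1| && ~~ odd `|x.2|)) (1 : int) = E.
  rewrite /E -[in RHS](eq_bigl _ _ (fun x => andbT (on_level _ _ n x))).
  apply: (@reindex_level 4 12 1 3 n xpredT (fun x => ~~ odd `|x.1| && ~~ odd `|x.2|)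
    (fun x => (2 * x.1, 2 * x.2)) (fun x => (x.1 %/ 2, x.2 %/ 2)%Z)) => // -[i j];
    rewrite /on_level /= => /eqP Hn Hp.
    by split; [apply/eqP; rewrite -Hn; ring | lia | congr pair; lia].
  have Ei : i = 2 * (i %/ 2)%Z by lia.
  have Ej : j = 2 * (j %/ 2)%Z by lia.
  by split; [apply/eqP; rewrite -Hn [in RHS]Ei [in RHS]Ej; ring | | rewrite -Ei -Ej].
(* For odd i and j, exactly one sign s makes i - s j divisible by 4; each sign accounts for [O]
   solutions. *)
have odd_odd s : s = 1 \/ s = -1 -> \sum_(x <- zpairs n | on_level 1 3 n x &&
    (odd `|x.1| && (4 %| x.1 - s * x.2)%Z)) (1 : int) = O.
  move=> s1; rewrite /O.
  apply: (@reindex_level 4 12 1 3 n (predC same_parity)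
    (fun x => odd `|x.1| && (4 %| x.1 - s * x.2)%Z)
    (fun x => (x.1 + 3 * x.2, s * (x.1 - x.2)))
    (fun x => (s * x.2 + ((x.1 - s * x.2) %/ 4)%Z, ((x.1 - s * x.2) %/ 4)%Z)))
    => // -[i j];
    rewrite /on_level /same_parity /= => /eqP Hn Hp.
    by split; [apply/eqP; rewrite -Hn | | congr pair]; case: s1 => ->; try ring; lia.
  have Ei : i = s * j + 4 * ((i - s * j) %/ 4)%Z by lia.
  set k := ((i - s * j) %/ 4)%Z in Ei *.
  split; [apply/eqP; rewrite -Hn Ei | | congr pair];
    case: s1 Hp Ei => ->; try (move=> _ _; ring); lia.
(* On the left the weight is 2 on even pairs, -2 on odd pairs and 0 on mixed ones. *)
transitivity ((E - O - O) *+ 2); last by ring.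
rewrite -{1}(odd_odd 1) ; last by left.
rewrite -(odd_odd (-1)); last by right.
rewrite -even_even -!big_split /= !big_mkcondr -!sumrB -sumrMnl.
apply: eq_bigr => -[i j] _ /=; rewrite /zsign.
case Oi: (odd `|i|); case Oj: (odd `|j|) => //=.
- have [H|H] : (4 %| i - 1 * j)%Z && ~~ (4 %| i - -1 * j)%Z \/
      ~~ (4 %| i - 1 * j)%Z && (4 %| i - -1 * j)%Z by lia.
    by have /andP[-> /negPf->] := H.
  by have /andP[/negPf-> ->] := H.
- have -> : (4 %| i - 1 * j)%Z = false by lia.
  by have -> : (4 %| i - -1 * j)%Z = false by lia.
Qed.

(** * Gauss's product for [phin] *)

Lemma big_zrange_recr n (P : pred int) (F : int -> int) :
  \sum_(i <- zrange n.+1 | P i) F i =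
  \sum_(i <- zrange n | P i) F i +
  ((if P n.+1%:Z then F n.+1%:Z else 0) + (if P (- n.+1%:Z) then F (- n.+1%:Z) else 0)).
Proof.
rewrite addrC (perm_big (n.+1%:Z :: - n.+1%:Z :: zrange n)); first last.
  apply: uniq_perm; first exact: zrange_uniq.
    by rewrite !cons_uniq zrange_uniq in_cons !mem_zrange; lia.
  by move=> i; rewrite mem_zrange !in_cons mem_zrange; lia.
by rewrite !big_cons /=; do 2 case: ifP => _; rewrite ?add0r ?addr0 ?addrA.
Qed.

Lemma big_zrange0 (P : pred int) (F : int -> int) :
  \sum_(i <- zrange 0 | P i) F i = if P 0 then F 0 else 0.
Proof.
rewrite (_ : zrange 0 = [:: 0]) ?big_cons ?big_nil ?addr0 //.
Qed.

Lemma coefs_theta0 w a : coefs (theta w a) 0 = w 0.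
Proof. by rewrite /= big_zrange0 /= mulr0 eqxx. Qed.

Lemma coefs_theta1 w a : coefs (theta w a) 1 = if a == 1 then w 1 + w (-1) else 0.
Proof.
rewrite /= big_zrange_recr big_zrange0 /= mulr0 add0r sqrrN expr1n mulr1 eqz_nat.
by case: (a == 1).
Qed.

Lemma coefs_XnM (a : {fps int}) m n : (n < m)%N -> coefs (q ^+ m * a) n = 0.
Proof.
move=> ltnm; rewrite coefsM big1 // => i _; rewrite coefsXn.
by rewrite ltn_eqF ?mul0r // (leq_ltn_trans _ ltnm) // -ltnS.
Qed.

Lemma coefs_sum (I : Type) (r : seq I) (F : I -> {fps int}) n :
  coefs (\sum_(i <- r) F i) n = \sum_(i <- r) coefs (F i) n.
Proof. exact: (big_morph (fun a => coefs a n)). Qed.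

Lemma coefs_phin_partial a n c :
  \sum_(i <- zrange n | a%:Z * i ^+ 2 == c%:Z) zsign i =
  coefs (1 + 2 * \sum_(j < n) (-1) ^+ j.+1 * (q ^+ a) ^+ (j.+1 ^ 2)) c.
Proof.
elim: n => [|n IHn].
  by rewrite big_zrange0 big_ord0 !mulr0 addr0 coefs1 eq_sym eqz_nat; case: eqP.
rewrite big_zrange_recr IHn big_ord_recr mulrDr [in RHS]addrA [in RHS]coefsD; congr (_ + _).
rewrite sqrrN mulr_natl mulr2n coefsD -exprM -signr_odd /zsign abszN absz_nat.
have -> : (a%:Z * n.+1%:Z ^+ 2 == c%:Z) = (c == a * n.+1 ^ 2)%N by lia.
have -> : coefs ((-1) ^+ odd n.+1 * q ^+ (a * n.+1 ^ 2)%N) c =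
    (-1) ^+ odd n.+1 * (c == a * n.+1 ^ 2)%N%:R.
  by case: odd; rewrite ?expr1 ?expr0 ?mulN1r ?mul1r ?coefsN coefsXn.
by case: eqP => _; rewrite ?mulr1 ?mulr0.
Qed.

Lemma unit1DXn a k : (0 < a)%N -> (0 < k)%N -> 1 + (q ^+ a) ^+ k \is a GRing.unit.
Proof.
move=> a0 k0; rewrite fps_unitE coefsD coefs1 -exprM coefsXn.
by have -> : (0%N == a * k)%N = false by nia.
Qed.

(* Gauss's identity: by [shanks], [phin a] is the limit of these products, since  *)
(* every term of Shanks' sum except the one with [s = 0] vanishes in the limit.   *)
Lemma phin_prod a n : (0 < a)%N ->
  fps_eqmod n.+1 (phin a) (shanks_prod (q ^+ a) 0 n).
Proof.
move=> a0 c ltcn; rewrite /phin (@coefs_theta _ _ _ n) // coefs_phin_partial.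
rewrite -shanks; last by move=> k; apply: unit1DXn.
rewrite big_ord_recl coefsD coefs_sum big1 ?addr0.
  by rewrite /shanks_term /shanks_weight mul0n !expr0 !mul1r.
move=> i _; rewrite /shanks_term [X in coefs (X * _)]mulrC -mulrA -exprM coefs_XnM //.
by rewrite (leq_trans ltcn) // mulnA leq_pmull // muln_gt0 a0.
Qed.

(** * The generating function as a theta quotient *)

Definition odd_prod (R : comUnitRingType) (t : R) n : R :=
  \prod_(0 <= k < n) ((1 - t ^+ (2 * k).+1) / (1 + t ^+ (2 * k).+1)).

Lemma shanks_prod_double (R : comUnitRingType) (t : R) n :
  shanks_prod t 0 (2 * n) = odd_prod t n * shanks_prod (t ^+ 2) 0 n.
Proof.
rewrite /odd_prod /shanks_prod -big_split /=.
elim: n => [|n IHn]; first by rewrite !big_geq.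
by rewrite mulnS !big_nat_recr //= IHn -exprM mulnS -mulrA.
Qed.

Lemma schur3_gf_prod r n :
  fps_eqmod n.+1 (schur3_gf r) (\prod_(1 <= k < n.+1) schur3_factor r k).
Proof. by move=> c ltcn; rewrite (fps_infprodP (@schur3_factor_eqmod r)). Qed.

Lemma schur3_gf2 : schur3_gf 2 = schur3_gf 1 ^+ 2.
Proof.
apply: fpsP => n; rewrite (schur3_gf_prod 2 (ltnSn n)) expr2.
rewrite (fps_eqmodM (schur3_gf_prod 1 (n := n)) (schur3_gf_prod 1 (n := n))) //.
rewrite -big_split /=; congr coefs; apply: eq_bigr => k _.
by rewrite -expr2 /schur3_factor !expr1 expr_div_n !exprMn.
Qed.

Lemma schur3_prod_odd n :
  \prod_(1 <= k < n.+1) schur3_factor 1 k * odd_prod q n = odd_prod (q ^+ 3) n.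
Proof.
rewrite big_add1 /= /odd_prod -big_split /=; apply: eq_bigr => k _.
rewrite /schur3_factor !expr1 (_ : 2 * k.+1 - 1 = (2 * k).+1)%N; last lia.
rewrite -exprM; set u := q ^+ (2 * k).+1; set v := q ^+ (3 * (2 * k).+1).
have U1 : 1 + u \is a GRing.unit by rewrite fps_unitE coefsD coefs1 coefsXn.
have U2 : 1 - u \is a GRing.unit by rewrite fps_unitE coefsB coefs1 coefsXn.
have U3 : 1 + v \is a GRing.unit by rewrite fps_unitE coefsD coefs1 coefsXn.
rewrite invrM //.
transitivity (((1 + u) / (1 + u)) * ((1 - u) / (1 - u)) * ((1 - v) / (1 + v))).
  by ring.
by rewrite !mulrV // !mul1r.
Qed.

(** Splitting off odd exponents makes [odd_prod] in q^a the ratio of [phin a] to [phin (2 * a)], and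
    A is the ratio of these products for a = 3 and a = 1. *)
Lemma schur3_gf_theta : schur3_gf 1 * phin 1 * phin 6 = phin 2 * phin 3.
Proof.
apply: fpsP => n.
have le2n : (n < (2 * n).+1)%N by lia.
(* [phin 1] and [phin 3] need 2n factors, so that their even half has the n factors used for
   [phin 2] and [phin 6]. *)
have half a b : fps_eqmod (2 * n).+1 a b -> fps_eqmod n.+1 a b.
  by move=> ab c ltcn; apply: ab; lia.
have E1 := half _ _ _ (@phin_prod 1 (2 * n) isT).
have E3 := half _ _ _ (@phin_prod 3 (2 * n) isT).
have E2 := @phin_prod 2 n isT.
have E6 := @phin_prod 6 n isT.
have EA := @schur3_gf_prod 1 n.
have -> := fps_eqmodM (fps_eqmodM EA E1) E6 (ltnSn n).
have -> := fps_eqmodM E2 E3 (ltnSn n).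
rewrite !shanks_prod_double expr1 -exprM -[(3 * 2)%N]/6%N -schur3_prod_odd.
set A := \big[_/_]_(_ <= _ < _) _; set B := odd_prod _ _.
set C := shanks_prod _ _ _; set D := shanks_prod _ _ _.
by congr (coefs _ n); move: A B C D => A B C D; ring.
Qed.

(* The substitutions [q := - q] and [q := q ^ 2]. *)
Definition fps_neg (a : {fps int}) : {fps int} := Fps (fun n => (-1) ^+ n * coefs a n).
Definition fps_dil (a : {fps int}) : {fps int} :=
  Fps (fun n => if odd n then 0 else coefs a n./2).

Lemma coefs_neg a n : coefs (fps_neg a) n = (-1) ^+ n * coefs a n.
Proof. by []. Qed.

Lemma coefs_dil a n : coefs (fps_dil a) n = if odd n then 0 else coefs a n./2.
Proof. by []. Qed.

Lemma fps_negM a b : fps_neg (a * b) = fps_neg a * fps_neg b.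
Proof.
apply: fpsP => n; rewrite coefsM [LHS]mulr_sumr; apply: eq_bigr => i _ /=.
by rewrite mulrACA -exprD subnKC // -ltnS.
Qed.

Lemma sum_odd0 (F : nat -> int) n : (forall k, odd k -> F k = 0) ->
  \sum_(i < n.+1) F i = \sum_(i < n./2.+1) F (2 * i)%N.
Proof.
move=> F0; elim: n => [|n IHn]; first by rewrite !big_ord1.
rewrite big_ord_recr IHn /= uphalf_half.
case On: (odd n); last by rewrite F0 /= ?On ?addr0.
by rewrite add1n [RHS]big_ord_recr /=; congr (_ + F _); lia.
Qed.

Lemma fps_dilM a b : fps_dil (a * b) = fps_dil a * fps_dil b.
Proof.
apply: fpsP => n; rewrite [RHS]coefsM.
rewrite (@sum_odd0 (fun i => coefs (fps_dil a) i * coefs (fps_dil b) (n - i)%N)) /=;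
  last by move=> k ->; rewrite mul0r.
case On: (odd n).
  rewrite big1 // => i _; have -> : odd (n - 2 * i) by have := ltn_ord i; lia.
  by rewrite mulr0.
apply: eq_bigr => i _; have lti := ltn_ord i.
have -> : odd (2 * i) = false by lia.
have -> : odd (n - 2 * i) = false by lia.
by congr (coefs a _ * coefs b _); lia.
Qed.

Lemma fps_neg_theta w a :
  fps_neg (theta w a) = theta (fun i => (-1) ^+ (odd a && odd `|i|) * w i) a.
Proof.
apply: fpsP => n /=; rewrite mulr_sumr; apply: eq_bigr => i /eqP Hi.
rewrite -signr_odd; congr (_ ^+ _ * _).
have -> : n = (a * `|i| ^ 2)%N by nia.
by rewrite oddM oddX.
Qed.

Lemma theta_ext w w' a : w =1 w' -> theta w a = theta w' a.
Proof. by move=> ww; apply: fpsP => n /=; apply: eq_bigr => i _; apply: ww. Qed.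

Lemma fps_neg_theta_even w a : ~~ odd a -> fps_neg (theta w a) = theta w a.
Proof.
by move=> /negPf Oa; rewrite fps_neg_theta Oa; apply: theta_ext => i; rewrite mul1r.
Qed.

Lemma fps_neg_phin_odd a : odd a -> fps_neg (phin a) = phi a.
Proof.
by move=> Oa; rewrite fps_neg_theta Oa; apply: theta_ext => i; rewrite /zsign; case: odd.
Qed.

Lemma fps_dil_theta w a : (0 < a)%N -> fps_dil (theta w a) = theta w (2 * a).
Proof.
move=> a0; apply: fpsP => n.
have -> : coefs (fps_dil (theta w a)) n = if odd n then 0 else coefs (theta w a) n./2.
  by [].
case On: (odd n).
  by rewrite /= big1 // => i /eqP; rewrite PoszM -mulrA; lia.
rewrite (@coefs_theta w a _ n) //; last by lia.
by apply: eq_bigl => i; rewrite PoszM -mulrA; lia.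
Qed.

(** * The modular equation of degree 3 *)

Lemma coefsM1 (a b : {fps int}) :
  coefs (a * b) 1 = coefs a 0 * coefs b 1 + coefs a 1 * coefs b 0.
Proof. by rewrite coefsM !big_ord_recl big_ord0 addr0. Qed.

(** As b has order exactly 1, coefficient n+1 of a b determines coefficient n of a from the earlier
    ones. *)
Lemma fps_mul_eq0 (a b : {fps int}) :
  coefs b 0 = 0 -> coefs b 1 != 0 -> a * b = 0 -> a = 0.
Proof.
move=> b0 b1 ab0; apply: fpsP => n; elim/ltn_ind: n => n IHn.
have := congr1 (fun c => coefs c n.+1) ab0.
rewrite coefsM 2!big_ord_recr /= subnn b0 mulr0 addr0 subSnn.
rewrite big1 ?add0r; last by move=> i _; rewrite IHn ?mul0r.
by move/eqP; rewrite mulf_eq0 (negPf b1) orbF => /eqP.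
Qed.

Lemma phin_unit a : phin a \is a GRing.unit.
Proof. by rewrite fps_unitE coefs_theta0. Qed.

(** With x = p1 m3 and y = m1 p3, (x^2 - y^2)^2 = (x + y)^4 - 4 x y (x + y)^2; the fourth power of
    the cubic identity loses p2, p6, m4, m12 through the other relations. *)
Lemma modular3_sqr (R : comNzRingType) (p1 m1 p3 m3 p2 m2 p6 m6 m4 m12 : R) :
    p1 * m1 = m2 ^+ 2 -> p3 * m3 = m6 ^+ 2 ->
    p2 * m2 = m4 ^+ 2 -> p6 * m6 = m12 ^+ 2 ->
    p1 ^+ 2 + m1 ^+ 2 = 2 * p2 ^+ 2 -> p3 ^+ 2 + m3 ^+ 2 = 2 * p6 ^+ 2 ->
    p1 * m3 + m1 * p3 = 2 * (m4 * m12) ->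
  (p1 ^+ 2 * m3 ^+ 2 - m1 ^+ 2 * p3 ^+ 2) ^+ 2 =
  (2 * (m2 * m6 * (p1 * p3 - m1 * m3))) ^+ 2.
Proof.
move=> h1 h3 h2 h6 d1 d3 c.
have -> : (2 * (m2 * m6 * (p1 * p3 - m1 * m3))) ^+ 2 =
    4 * (m2 ^+ 2) * (m6 ^+ 2) * (p1 * p3 - m1 * m3) ^+ 2 by ring.
have c4 : (p1 * m3 + m1 * p3) ^+ 4 =
    4 * (p1 ^+ 2 + m1 ^+ 2) * (p3 ^+ 2 + m3 ^+ 2) * (p1 * m1) * (p3 * m3).
  rewrite c d1 d3 h1 h3.
  transitivity (16 * (m4 ^+ 2) ^+ 2 * (m12 ^+ 2) ^+ 2); first by ring.
  by rewrite -h2 -h6; ring.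
rewrite -h1 -h3.
transitivity ((p1 * m3 + m1 * p3) ^+ 4 -
    4 * (p1 * m3) * (m1 * p3) * (p1 * m3 + m1 * p3) ^+ 2); first by ring.
by rewrite c4; ring.
Qed.

(* Both sides have the same square; comparing coefficients of [q] fixes the sign. *)
Lemma phi_modular3 :
  phi 1 ^+ 2 * phin 3 ^+ 2 - phin 1 ^+ 2 * phi 3 ^+ 2 =
  2 * (phin 2 * phin 6 * (phi 1 * phi 3 - phin 1 * phin 3)).
Proof.
set U := LHS; set V := RHS.
have UV2 : U ^+ 2 = V ^+ 2.
  exact: modular3_sqr (@phi_mul_phin 1 isT) (@phi_mul_phin 3 isT)
    (@phi_mul_phin 2 isT) (@phi_mul_phin 6 isT) (@phi_sqr_add_phin_sqr 1 isT)
    (@phi_sqr_add_phin_sqr 3 isT) phi_phin_cubic.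
apply/eqP; rewrite -subr_eq0; apply/eqP; apply: (@fps_mul_eq0 _ (U + V)).
(* U and V both start with 8 q, so U + V has order 1 and can be cancelled from (U - V)(U + V) =
   0. *)
- by rewrite /U /V !(coefsD, coefsN, coefsM0, expr2) !coefs_theta0.
- rewrite /U /V mulr_natl mulr2n !(coefsD, coefsN, coefsM1, coefsM0, expr2).
  by rewrite !coefs_theta0 !coefs_theta1.
- by rewrite -subr_sqr UV2 subrr.
Qed.

(** * Even and odd parts, and the conclusion *)

Lemma dissection_sum (R : comUnitRingType) (p1 m1 m2 p3 m3 m6 m4 m12 A nA dE : R) :
    p1 * m1 = m2 ^+ 2 -> p1 * m3 + m1 * p3 = 2 * (m4 * m12) ->
    m2 \is a GRing.unit -> m6 \is a GRing.unit ->
    A * m1 * m6 = m2 * m3 -> nA * p1 * m6 = m2 * p3 ->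
    dE * (m2 * m6) = m4 * m12 ->
  A + nA = 2 * dE.
Proof.
move=> h1 c U2 U6 hA hnA hdE.
apply: (@mulIr _ (m2 ^+ 2 * m6)); first by rewrite unitrM unitrX.
transitivity (m2 * (2 * (dE * (m2 * m6)))); last by ring.
rewrite hdE -c -h1.
transitivity ((A * m1 * m6) * p1 + (nA * p1 * m6) * m1); first by ring.
by rewrite hA hnA; ring.
Qed.

Lemma dissection_diff (R : comUnitRingType) (p1 m1 m2 p3 m3 m6 A nA E nE : R) :
    p1 * m1 = m2 ^+ 2 -> p3 * m3 = m6 ^+ 2 ->
    p1 ^+ 2 * m3 ^+ 2 - m1 ^+ 2 * p3 ^+ 2 = 2 * (m2 * m6 * (p1 * p3 - m1 * m3)) ->
    m2 \is a GRing.unit -> m6 \is a GRing.unit ->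
    A * m1 * m6 = m2 * m3 -> nA * p1 * m6 = m2 * p3 ->
    E * (m1 * m3) = m2 * m6 -> nE * (p1 * p3) = m2 * m6 ->
  A * A - nA * nA = 2 * (E - nE).
Proof.
move=> h1 h3 k U2 U6 hA hnA hE hnE.
apply: (@mulIr _ (m2 ^+ 2 * m2 ^+ 2 * m6 ^+ 2)); first by rewrite !unitrM U2 U6.
transitivity (m2 ^+ 2 *
    (2 * (E * (m1 * m3) * (p1 * p3) - nE * (p1 * p3) * (m1 * m3)))); first last.
  by rewrite -h1 -h3; ring.
rewrite hE hnE -mulrBr -k.
transitivity ((A * m1 * m6) ^+ 2 * p1 ^+ 2 - (nA * p1 * m6) ^+ 2 * m1 ^+ 2).
  by rewrite -h1; ring.
by rewrite hA hnA; ring.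
Qed.

Theorem theorem4p3 (n : nat) :
  schur3 2 (2 * n + 1)%N = 2 * schur3 1 (4 * n + 2)%N.
Proof.
have N1 : fps_neg (phin 1) = phi 1 := @fps_neg_phin_odd 1 isT.
have N3 : fps_neg (phin 3) = phi 3 := @fps_neg_phin_odd 3 isT.
have N2 : fps_neg (phin 2) = phin 2 by apply: fps_neg_theta_even.
have N6 : fps_neg (phin 6) = phin 6 by apply: fps_neg_theta_even.
pose A := schur3_gf 1.
pose E := phin 2 * phin 6 / (phin 1 * phin 3).
have hA : A * phin 1 * phin 6 = phin 2 * phin 3 := schur3_gf_theta.
have hE : E * (phin 1 * phin 3) = phin 2 * phin 6.
  by rewrite /E divrK // unitrM !phin_unit.
have hnA : fps_neg A * phi 1 * phin 6 = phin 2 * phi 3.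
  by have := congr1 fps_neg hA; rewrite !fps_negM N1 N2 N3 N6.
have hnE : fps_neg E * (phi 1 * phi 3) = phin 2 * phin 6.
  by have := congr1 fps_neg hE; rewrite !fps_negM N1 N2 N3 N6.
have hdE : fps_dil E * (phin 2 * phin 6) = phin 4 * phin 12.
  by have := congr1 fps_dil hE; rewrite !fps_dilM /phin !fps_dil_theta.
have sumA := dissection_sum (@phi_mul_phin 1 isT) phi_phin_cubic
  (phin_unit 2) (phin_unit 6) hA hnA hdE.
have diffA := dissection_diff (@phi_mul_phin 1 isT) (@phi_mul_phin 3 isT) phi_modular3
  (phin_unit 2) (phin_unit 6) hA hnA hE hnE.
(* Both coefficients are multiples of the one of q^(2n+1) in E, since E(q^2) carries it at
   q^(4n+2). *)
have {sumA} := congr1 (fun a => coefs a (4 * n + 2)%N) sumA.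
have {diffA} := congr1 (fun a => coefs a (2 * n + 1)%N) diffA.
rewrite /schur3 schur3_gf2 -/A expr2.
rewrite -fps_negM !mulr_natl !mulr2n !(coefsD, coefsN) !coefs_neg coefs_dil.
have -> : odd (4 * n + 2) = false by lia.
have -> : (4 * n + 2)./2 = (2 * n + 1)%N by lia.
rewrite -[(-1) ^+ (4 * n + 2)]signr_odd -[(-1) ^+ (2 * n + 1)]signr_odd.
have -> : odd (4 * n + 2) = false by lia.
have -> : odd (2 * n + 1) by lia.
move: (coefs _ _) (coefs _ _) (coefs _ _) => x y z.
by rewrite expr0 expr1; lia.
Qed.
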